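(* Let $n$ be a positive integer and let $\mathcal A$ be an abelian $n$-truncated DG-category. By regarding every homotopy short exact sequence as a conflation, $\mathcal A$ becomes an exact DG-category; in it the inflations are exactly the $n$-monomorphisms and the deflations are exactly the $n$-epimorphisms.
   Context: **DG-categories.** Let $k$ be a commutative ring. DG-categories are $k$-linear with cohomological grading (differential $d$ of degree $+1$). All DG-categories $\mathcal A$ are assumed non-positive: $\mathcal A(X,Y)^i=0$ for $i>0$. A morphism $f$ is closed if $d(f)=0$; a homotopy equivalence is a closed degree-$0$ morphism invertible in the homotopy category $H^0(\mathcal A)$. **Exactness.** For a chain map $\varphi:M\to N$ let $\mathrm{Fib}(\varphi)=\mathrm{Cone}(\varphi)[-1]$ be the complex $\mathrm{Fib}(\varphi)^i=M^i\oplus N^{i-1}$, $d(m,h)=(dm,-\varphi(m)-dh)$. A 3-term homotopy complex $(f,g,h)$ consists of closed degree-$0$ morphisms $f:X\to Y$, $g:Y\to Z$ and a degree $-1$ morphism $h:X\to Z$ with $d(h)=-g\circ f$. It is left exact (a homotopy kernel of $g$) if for every object $W$ and every $i\le 0$ the chain map $\mathcal A(W,X)\to \mathrm{Fib}(g\circ-:\mathcal A(W,Y)\to\mathcal A(W,Z))$, $u\mapsto (f\circ u,h\circ u)$, induces an isomorphism on $H^i$. It is right exact (a homotopy cokernel of $f$) if for every $W$ and $i\le0$ the chain map $\mathcal A(Z,W)\to\mathrm{Fib}(-\circ f:\mathcal A(Y,W)\to\mathcal A(X,W))$, $u\mapsto(u\circ g,(-1)^{|u|}u\circ h)$, induces an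 isomorphism on $H^i$. It is a homotopy short exact sequence if it is both. A morphism $(f,g,h)\to(f',g',h')$ of 3-term homotopy complexes is $(x,y,z,s,s',t)$ with $x:X\to X'$, $y:Y\to Y'$, $z:Z\to Z'$ closed of degree $0$, $s:X\to Y'$, $s':Y\to Z'$ of degree $-1$, $t:X\to Z'$ of degree $-2$, $d(s)=f'x-yf$, $d(s')=g'y-zg$, $d(t)=zh-s'f-g's-h'x$. It is an isomorphism (in the homotopy category of 3-term complexes) iff $x,y,z$ are homotopy equivalences. **Homotopy (co)Cartesian squares.** A square consists of closed degree-$0$ morphisms $g:B\to B'$, $a:B\to A$, $a':B'\to A'$, $f:A\to A'$ and $s:B\to A'$ of degree $-1$ with $d(s)=fa-a'g$. It is homotopy Cartesian (a homotopy fiber product of $f$ and $a'$) if for all $W$ and $i\le 0$ the map $\mathcal A(W,B)\to\mathrm{Fib}\big((u,v)\mapsto fu-a'v:\mathcal A(W,A)\oplus\mathcal A(W,B')\to\mathcal A(W,A')\big)$, $w\mapsto(aw,gw,-sw)$, induces an isomorphism on $H^i$. Homotopy co-Cartesian squares are defined dually. **Exact DG-categories.** Let $\mathcal S$ be a class of 3-term homotopy complexes of $\mathcal A$ closed under isomorphism, called conflations; for $(f,g,h)\in\mathcal S$ call $f$ an inflation and $g$ a deflation. $(\mathcal A,\mathcal S)$ is an exact DG-category if: (Ex0) $\mathrm{id}_A$ is a deflation for all $A$; (Ex1) deflations are closed under composition; (Ex2) for every deflation $g:B'\to C'$ and every closed degree-$0$ $c:C\to C'$ the homotopy fiber product of $g$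 and $c$ exists, and deflations are preserved under homotopy fiber products; (Ex2)' the dual of (Ex2) (inflations and homotopy fiber coproducts). **Abelian $n$-truncated DG-categories.** A closed degree-$0$ morphism $f:X\to Y$ is an $n$-monomorphism if for every $W$ the map $H^i(f\circ-):H^i(\mathcal A(W,X))\to H^i(\mathcal A(W,Y))$ is injective for $i=-n+1$ and bijective for all $i\le -n$; it is an $n$-epimorphism if it is an $n$-monomorphism in $\mathcal A^{\mathrm{op}}$. $\mathcal A$ is $n$-truncated if $H^i(\mathcal A(X,Y))=0$ for all $X,Y$ and all $i\le -n$. $\mathcal A$ is abelian $n$-truncated if it is $n$-truncated and: (i) it is preabelian, i.e. $H^0(\mathcal A)$ is additive and every closed degree-$0$ morphism has a homotopy kernel and a homotopy cokernel; (ii) every right exact $(f,g,h)$ with $f$ an $n$-monomorphism is a homotopy short exact sequence; (iii) every left exact $(f,g,h)$ with $g$ an $n$-epimorphism is a homotopy short exact sequence. *)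

(* Defs.v *)
From HB Require Import structures.
From mathcomp Require Import all_boot all_order all_algebra.
From mathcomp Require Import zify.

Set Implicit Arguments.
Unset Strict Implicit.
Unset Printing Implicit Defensive.

Import GRing.Theory.
Local Open Scope ring_scope.

(* Degrees are integers.  Degree-changing operations take a proof that source
   and target degrees match, so that no transport is needed to type, e.g.,
   associativity; these proofs are irrelevant since [int] has decidable
   equality. *)

Section Cochain.
Variable k : comPzRingType.

Record cochain := Cochain {
  cc_obj :> int -> lmodType k;
  cc_d : forall i j : int, i + 1 = j -> cc_obj i -> cc_obj j;
  cc_d_linear : forall (i j : int) (e : i + 1 = j), linear (cc_d e);
  cc_dd : forall (i j l : int) (e : i + 1 = j) (e' : j + 1 = l) (x : cc_obj i),
    cc_d e' (cc_d e x) = 0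
}.

HB.instance Definition _ (M : cochain) (i j : int) (e : i + 1 = j) :=
  GRing.isLinear.Build k (M i) (M j) *:%R (@cc_d M i j e) (cc_d_linear e).

Record cocycle (M : cochain) (i : int) := Cocycle {
  cval :> M i;
  cclosed : cc_d (erefl (i + 1)) cval = 0
}.

(* Equality of classes in H^i(M), viewed as cocycles modulo coboundaries. *)
Definition cohomologous (M : cochain) (i : int) (x y : M i) : Prop :=
  exists w : M (i - 1), cc_d (subrK 1 i) w = x - y.

Definition H_zero (M : cochain) (i : int) : Prop :=
  forall x : cocycle M i, cohomologous (x : M i) 0.

Record chain_map (M N : cochain) := ChainMap {
  cm_fun :> forall i : int, M i -> N i;
  cm_linear : forall i : int, linear (@cm_fun i);
  cm_d : forall (i j : int) (e : i + 1 = j) (x : M i),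
    cm_fun (cc_d e x) = cc_d e (cm_fun x)
}.

HB.instance Definition _ (M N : cochain) (phi : chain_map M N) (i : int) :=
  GRing.isLinear.Build k (M i) (N i) *:%R (@cm_fun M N phi i) (@cm_linear M N phi i).

(* H^i(phi) is injective, resp. surjective, resp. bijective. *)
Definition H_inj (M N : cochain) (phi : chain_map M N) (i : int) : Prop :=
  forall x y : cocycle M i, cohomologous (phi i x) (phi i y) ->
    cohomologous (x : M i) (y : M i).

Definition H_surj (M N : cochain) (phi : chain_map M N) (i : int) : Prop :=
  forall y : cocycle N i, exists x : cocycle M i, cohomologous (phi i x) (y : N i).

Definition H_bij (M N : cochain) (phi : chain_map M N) (i : int) : Prop :=
  H_inj phi i /\ H_surj phi i.

Definition degcast (M : cochain) (i j : int) (e : i = j) (x : M i) : M j :=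
  ecast l (M l) e x.

Lemma degcast_linear (M : cochain) (i j : int) (e : i = j) :
  linear (@degcast M i j e).
Proof. by case: _ / e. Qed.

HB.instance Definition _ (M : cochain) (i j : int) (e : i = j) :=
  GRing.isLinear.Build k (M i) (M j) *:%R (@degcast M i j e) (degcast_linear e).

Lemma degcast_d (M : cochain) (i j i' j' : int) (ei : i = i') (ej : j = j')
    (e : i + 1 = j) (e' : i' + 1 = j') (x : M i) :
  cc_d e' (degcast ei x) = degcast ej (cc_d e x).
Proof. by subst i' j'; rewrite (eq_irrelevance e e'). Qed.

Lemma degcast_id (M : cochain) (i : int) (e : i = i) (x : M i) :
  degcast e x = x.
Proof. by rewrite (eq_irrelevance e erefl). Qed.

Section DirectSum.
Variables M N : cochain.

Definition dsum_obj (i : int) : lmodType k := (M i * N i)%type.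

Definition dsum_d (i j : int) (e : i + 1 = j) (x : dsum_obj i) : dsum_obj j :=
  (cc_d e x.1, cc_d e x.2).

Lemma dsum_d_linear (i j : int) (e : i + 1 = j) : linear (dsum_d e).
Proof. by move=> a [x1 x2] [y1 y2]; rewrite /dsum_d /= !linearP. Qed.

Lemma dsum_dd (i j l : int) (e : i + 1 = j) (e' : j + 1 = l) (x : dsum_obj i) :
  dsum_d e' (dsum_d e x) = 0.
Proof. by rewrite /dsum_d /= !cc_dd. Qed.

Definition dsum : cochain := Cochain dsum_d_linear dsum_dd.
End DirectSum.

Section Fiber.
Variables (M N : cochain) (phi : chain_map M N).

Lemma fib_deg (i j : int) : i + 1 = j -> i = j - 1.
Proof. by move<-; rewrite addrK. Qed.

Lemma fib_deg' (i j : int) : i + 1 = j -> (i - 1) + 1 = j - 1.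
Proof. by move<-; rewrite addrAC. Qed.

Definition Fib_obj (i : int) : lmodType k := (M i * N (i - 1)%R)%type.

Definition Fib_d (i j : int) (e : i + 1 = j) (x : Fib_obj i) : Fib_obj j :=
  (cc_d e x.1, - degcast (fib_deg e) (phi i x.1) - cc_d (fib_deg' e) x.2).

Lemma Fib_d_linear (i j : int) (e : i + 1 = j) : linear (Fib_d e).
Proof.
move=> a [x1 x2] [y1 y2]; rewrite /Fib_d /= !linearP.
by rewrite addrACA -scalerDr.
Qed.

Lemma Fib_dd (i j l : int) (e : i + 1 = j) (e' : j + 1 = l) (x : Fib_obj i) :
  Fib_d e' (Fib_d e x) = 0.
Proof.
rewrite /Fib_d /= cc_dd; congr pair.
rewrite linearB linearN /= cc_dd subr0 opprK.
by rewrite (degcast_d (fib_deg e) (fib_deg e') e) cm_d addNr.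
Qed.

Definition Fib : cochain := Cochain Fib_d_linear Fib_dd.
End Fiber.

(* (-1)^i; the exponent |i| has the parity of i, and is a natural number. *)
Definition sgk (i : int) : k := (-1) ^+ `|i|%N.

Lemma sgkD (i j : int) : sgk (i + j) = sgk i * sgk j.
Proof.
rewrite /sgk -exprD -signr_odd -[RHS]signr_odd; congr (_ ^+ nat_of_bool _).
by lia.
Qed.

Lemma sgk_sq (i : int) : sgk i * sgk i = 1.
Proof. by rewrite -expr2 sqrr_sign. Qed.

End Cochain.

Record dgcat (k : comPzRingType) := DGCat {
  ob :> Type;
  hom : ob -> ob -> cochain k;
  comp : forall (X Y Z : ob) (i j l : int), i + j = l ->
    hom Y Z i -> hom X Y j -> hom X Z l;
  idm : forall X : ob, hom X X 0;
  comp_linearr : forall (X Y Z : ob) (i j l : int) (e : i + j = l)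
    (g : hom Y Z i), linear (fun f : hom X Y j => comp e g f);
  comp_linearl : forall (X Y Z : ob) (i j l : int) (e : i + j = l)
    (f : hom X Y j), linear (fun g : hom Y Z i => comp e g f);
  comp_assoc : forall (X Y Z W : ob) (a b c ab bc abc : int)
    (eab : a + b = ab) (ebc : b + c = bc)
    (el : ab + c = abc) (er : a + bc = abc)
    (h : hom Z W a) (g : hom Y Z b) (f : hom X Y c),
    comp el (comp eab h g) f = comp er h (comp ebc g f);
  comp_idl : forall (X Y : ob) (i : int) (f : hom X Y i),
    comp (add0r i) (idm Y) f = f;
  comp_idr : forall (X Y : ob) (i : int) (f : hom X Y i),
    comp (addr0 i) f (idm X) = f;
  comp_leibniz : forall (X Y Z : ob) (i j l i' j' l' : int)
    (e : i + j = l) (el : l + 1 = l')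
    (ei : i + 1 = i') (eg : i' + j = l')
    (ej : j + 1 = j') (ef : i + j' = l')
    (g : hom Y Z i) (f : hom X Y j),
    cc_d el (comp e g f) =
      comp eg (cc_d ei g) f + sgk k i *: comp ef g (cc_d ej f);
  hom_nonpos : forall (X Y : ob) (i : int) (f : hom X Y i),
    (0 < i)%R -> f = 0
}.

Arguments comp {k d X Y Z i j l} e g f.
Arguments idm {k d} X.
Arguments hom {k d} X Y.

Section DG.
Variables (k : comPzRingType) (A : dgcat k).

HB.instance Definition _ (X Y Z : A) (i j l : int) (e : i + j = l)
    (g : hom Y Z i) :=
  GRing.isLinear.Build k (hom X Y j) (hom X Z l) *:%R (comp e g)
    (comp_linearr e g).

Definition compl (X Y Z : A) (i j l : int) (e : i + j = l) (f : hom X Y j)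
    (g : hom Y Z i) : hom X Z l := comp e g f.

HB.instance Definition _ (X Y Z : A) (i j l : int) (e : i + j = l)
    (f : hom X Y j) :=
  GRing.isLinear.Build k (hom Y Z i) (hom X Z l) *:%R (compl e f)
    (comp_linearl e f).

Lemma comp0r (X Y Z : A) (i j l : int) (e : i + j = l) (g : hom Y Z i) :
  comp e g (0 : hom X Y j) = 0.
Proof. exact: linear0. Qed.

Lemma comp0l (X Y Z : A) (i j l : int) (e : i + j = l) (f : hom X Y j) :
  comp e (0 : hom Y Z i) f = 0.
Proof. exact: (linear0 (compl e f)). Qed.

Lemma compNl (X Y Z : A) (i j l : int) (e : i + j = l) (g : hom Y Z i)
    (f : hom X Y j) : comp e (- g) f = - comp e g f.
Proof. exact: (linearN (compl e f)). Qed.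

Lemma compDl (X Y Z : A) (i j l : int) (e : i + j = l) (g g' : hom Y Z i)
    (f : hom X Y j) : comp e (g + g') f = comp e g f + comp e g' f.
Proof. exact: (linearD (compl e f)). Qed.

Lemma compZl (X Y Z : A) (i j l : int) (e : i + j = l) a (g : hom Y Z i)
    (f : hom X Y j) : comp e (a *: g) f = a *: comp e g f.
Proof. exact: (linearZ_LR (compl e f)). Qed.

Lemma comp_degcast (X Y Z : A) (i j l l' : int) (e : i + j = l)
    (e' : i + j = l') (el : l = l') (g : hom Y Z i) (f : hom X Y j) :
  degcast el (comp e g f) = comp e' g f.
Proof. by case: _ / el e' => e'; rewrite (eq_irrelevance e e'). Qed.

Definition Z0 (X Y : A) := cocycle (hom X Y) 0.

Lemma cclosedE (X Y : A) (f : Z0 X Y) (j : int) (e : 0 + 1 = j) :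
  cc_d e (cval f) = 0.
Proof. by subst j; rewrite cclosed. Qed.

Lemma comp0_closed (X Y Z : A) (g : Z0 Y Z) (f : Z0 X Y) :
  cc_d (erefl (0 + 1)) (comp (add0r 0) (cval g) (cval f)) = 0.
Proof.
rewrite (comp_leibniz _ _ (add0r 1) (addr0 1) (add0r 1) (add0r 1)).
by rewrite !cclosedE comp0l comp0r scaler0 addr0.
Qed.

Definition comp0 (X Y Z : A) (g : Z0 Y Z) (f : Z0 X Y) : Z0 X Z :=
  Cocycle (comp0_closed g f).

Lemma idm_closed (X : A) : cc_d (erefl (0 + 1)) (idm X : hom X X 0) = 0.
Proof. by apply: hom_nonpos. Qed.

Definition id0 (X : A) : Z0 X X := Cocycle (idm_closed X).

(* Equality in H^0(A). *)
Definition homotopic (X Y : A) (f g : hom X Y 0) : Prop := cohomologous f g.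

Definition hequiv (X Y : A) (f : Z0 X Y) : Prop :=
  exists g : Z0 Y X, homotopic (comp0 g f) (id0 X) /\ homotopic (comp0 f g) (id0 Y).

Section Whisker.
Variables (X Y : A) (f : Z0 X Y) (W : A).

Definition post_fun (i : int) (u : hom W X i) : hom W Y i :=
  comp (add0r i) (cval f) u.

Lemma post_linear (i : int) : linear (@post_fun i).
Proof. exact: comp_linearr. Qed.

Lemma post_d (i j : int) (e : i + 1 = j) (u : hom W X i) :
  post_fun (cc_d e u) = cc_d e (post_fun u).
Proof.
rewrite /post_fun (comp_leibniz _ e (add0r 1) (etrans (addrC 1 i) e) e (add0r j)).
by rewrite cclosedE comp0l add0r scale1r.
Qed.

Definition postcomp : chain_map (hom W X) (hom W Y) := ChainMap post_linear post_d.

Definition pre_fun (i : int) (u : hom Y W i) : hom X W i :=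
  comp (addr0 i) u (cval f).

Lemma pre_linear (i : int) : linear (@pre_fun i).
Proof. exact: comp_linearl. Qed.

Lemma pre_d (i j : int) (e : i + 1 = j) (u : hom Y W i) :
  pre_fun (cc_d e u) = cc_d e (pre_fun u).
Proof.
rewrite /pre_fun (comp_leibniz _ e e (addr0 j) (add0r 1) e).
by rewrite cclosedE comp0r scaler0 addr0.
Qed.

Definition precomp : chain_map (hom Y W) (hom X W) := ChainMap pre_linear pre_d.
End Whisker.

Record complex3 := Complex3 {
  c3X : A; c3Y : A; c3Z : A;
  c3f : Z0 c3X c3Y;
  c3g : Z0 c3Y c3Z;
  c3h : hom c3X c3Z (-1);
  c3dh : cc_d (addNr 1) c3h = - cval (comp0 c3g c3f)
}.

Section Comparison.
Variables (c : complex3) (W : A).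

Definition left_fun (i : int) (u : hom W (c3X c) i) :
    Fib (postcomp (c3g c) W) i :=
  (comp (add0r i) (cval (c3f c)) u, comp (addrC (-1) i) (c3h c) u).

Lemma left_linear (i : int) : linear (@left_fun i).
Proof. by move=> a u v; rewrite /left_fun !linearP. Qed.

Lemma left_d (i j : int) (e : i + 1 = j) (u : hom W (c3X c) i) :
  left_fun (cc_d e u) = cc_d e (left_fun u).
Proof.
rewrite /left_fun /= /Fib_d /=; congr pair; first exact: (post_d (c3f c) e u).
rewrite (comp_leibniz _ _ (addNr 1) (etrans (add0r i) (fib_deg e)) e (addrC _ _)).
rewrite c3dh compNl /= /post_fun.
rewrite -(comp_assoc (add0r 0) (add0r i) (add0r i) (add0r i)).
rewrite (comp_degcast _ (etrans (add0r i) (fib_deg e))).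
by rewrite /sgk expr1 scaleN1r opprD !opprK addKr.
Qed.

Definition left_cmp : chain_map (hom W (c3X c)) (Fib (postcomp (c3g c) W)) :=
  ChainMap left_linear left_d.

Definition right_fun (i : int) (u : hom (c3Z c) W i) :
    Fib (precomp (c3f c) W) i :=
  (comp (addr0 i) u (cval (c3g c)),
   sgk k i *: comp (erefl (i - 1)) u (c3h c)).

Lemma right_linear (i : int) : linear (@right_fun i).
Proof.
move=> a u v; rewrite /right_fun.
rewrite !compDl !compZl scalerDr !scalerA (mulrC (sgk k i) a) -scalerA.
by [].
Qed.

Lemma right_d (i j : int) (e : i + 1 = j) (u : hom (c3Z c) W i) :
  right_fun (cc_d e u) = cc_d e (right_fun u).
Proof.
rewrite /right_fun /= /Fib_d /=; congr pair; first exact: (pre_d (c3g c) e u).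
rewrite linearZ /=.
rewrite (comp_leibniz _ _ e (erefl (j - 1)) (addNr 1) (etrans (addr0 i) (fib_deg e))).
rewrite c3dh linearN /= /pre_fun.
rewrite (comp_assoc (addr0 i) (add0r 0) (addr0 i) (addr0 i)).
rewrite (comp_degcast _ (etrans (addr0 i) (fib_deg e))).
rewrite scalerDr scalerA sgk_sq scale1r opprD opprK addrCA addNr addr0.
by rewrite -[in sgk k j]e sgkD [sgk k 1]expr1 mulrN1 scaleNr.
Qed.

Definition right_cmp : chain_map (hom (c3Z c) W) (Fib (precomp (c3f c) W)) :=
  ChainMap right_linear right_d.
End Comparison.

Definition left_exact (c : complex3) : Prop :=
  forall (W : A) (i : int), i <= 0 -> H_bij (left_cmp c W) i.

Definition right_exact (c : complex3) : Prop :=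
  forall (W : A) (i : int), i <= 0 -> H_bij (right_cmp c W) i.

Definition short_exact (c : complex3) : Prop := left_exact c /\ right_exact c.

Record mor3 (c c' : complex3) := Mor3 {
  m3x : Z0 (c3X c) (c3X c');
  m3y : Z0 (c3Y c) (c3Y c');
  m3z : Z0 (c3Z c) (c3Z c');
  m3s : hom (c3X c) (c3Y c') (-1);
  m3s' : hom (c3Y c) (c3Z c') (-1);
  m3t : hom (c3X c) (c3Z c') (- 2);
  m3ds : cc_d (addNr 1) m3s =
    cval (comp0 (c3f c') m3x) - cval (comp0 m3y (c3f c));
  m3ds' : cc_d (addNr 1) m3s' =
    cval (comp0 (c3g c') m3y) - cval (comp0 m3z (c3g c));
  m3dt : cc_d (erefl : - 2 + 1 = -1 :> int) m3t =
    comp (add0r (-1)) (cval m3z) (c3h c)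
    - comp (addr0 (-1)) m3s' (cval (c3f c))
    - comp (add0r (-1)) (cval (c3g c')) m3s
    - comp (addr0 (-1)) (c3h c') (cval m3x)
}.

Definition iso3 (c c' : complex3) : Prop :=
  exists m : mor3 c c', [/\ hequiv (m3x m), hequiv (m3y m) & hequiv (m3z m)].

(*      B --g--> B'
        |a       |a'     with d(s) = f a - a' g.
        A --f--> A'                                  *)
Record square := Square {
  sqB : A; sqB' : A; sqA : A; sqA' : A;
  sqg : Z0 sqB sqB';
  sqa : Z0 sqB sqA;
  sqa' : Z0 sqB' sqA';
  sqf : Z0 sqA sqA';
  sqs : hom sqB sqA' (-1);
  sqds : cc_d (addNr 1) sqs =
    cval (comp0 sqf sqa) - cval (comp0 sqa' sqg)
}.

Section SquareComparison.
Variables (q : square) (W : A).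

Definition cospan_fun (i : int) (x : dsum (hom W (sqA q)) (hom W (sqB' q)) i) :
    hom W (sqA' q) i :=
  postcomp (sqf q) W i x.1 - postcomp (sqa' q) W i x.2.

Lemma cospan_linear (i : int) : linear (@cospan_fun i).
Proof.
move=> a [x1 x2] [y1 y2].
have E1 := cm_linear (postcomp (sqf q) W) (i := i) a x1 y1.
have E2 := cm_linear (postcomp (sqa' q) W) (i := i) a x2 y2.
apply: (etrans (congr2 (fun u v => u - v) E1 E2)).
by rewrite opprD addrACA -scalerBr.
Qed.

Lemma cospan_d (i j : int) (e : i + 1 = j)
    (x : dsum (hom W (sqA q)) (hom W (sqB' q)) i) :
  cospan_fun (cc_d e x) = cc_d e (cospan_fun x).
Proof. by rewrite /cospan_fun linearB !cm_d. Qed.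

Definition cospan_map :
    chain_map (dsum (hom W (sqA q)) (hom W (sqB' q))) (hom W (sqA' q)) :=
  ChainMap cospan_linear cospan_d.

Definition square_fun (i : int) (w : hom W (sqB q) i) : Fib cospan_map i :=
  ((comp (add0r i) (cval (sqa q)) w, comp (add0r i) (cval (sqg q)) w),
   - comp (addrC (-1) i) (sqs q) w).

Lemma square_linear (i : int) : linear (@square_fun i).
Proof.
move=> a u v; rewrite /square_fun !linearP /=.
by congr pair; rewrite /= scalerN opprD.
Qed.

Lemma square_d (i j : int) (e : i + 1 = j) (w : hom W (sqB q) i) :
  square_fun (cc_d e w) = cc_d e (square_fun w).
Proof.
rewrite /square_fun /= /Fib_d /=; congr pair.
  by congr pair; [exact: (post_d (sqa q) e w) | exact: (post_d (sqg q) e w)].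
rewrite linearN opprK /=.
rewrite (comp_leibniz _ _ (addNr 1) (etrans (add0r i) (fib_deg e)) e (addrC _ _)).
rewrite sqds compDl compNl /cospan_fun /= /post_fun.
rewrite -!(comp_assoc (add0r 0) (add0r i) (add0r i) (add0r i)).
rewrite linearB /= !(comp_degcast _ (etrans (add0r i) (fib_deg e))).
by rewrite /sgk expr1 scaleN1r addKr.
Qed.

Definition square_cmp : chain_map (hom W (sqB q)) (Fib cospan_map) :=
  ChainMap square_linear square_d.
End SquareComparison.

Definition hcartesian (q : square) : Prop :=
  forall (W : A) (i : int), i <= 0 -> H_bij (square_cmp q W) i.

Definition n_mono (n : nat) (X Y : A) (f : Z0 X Y) : Prop :=
  forall W : A,
    H_inj (postcomp f W) (- n%:Z + 1) /\
    forall i : int, i <= - n%:Z -> H_bij (postcomp f W) i.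

Definition truncated (n : nat) : Prop :=
  forall (X Y : A) (i : int), i <= - n%:Z -> H_zero (hom X Y) i.

(* H^0(A) is k-linear by construction, so additivity amounts to a zero object
   and binary biproducts. *)
Definition H0_additive : Prop :=
  (exists O : A, forall W : A, H_zero (hom W O) 0 /\ H_zero (hom O W) 0) /\
  (forall X Y : A, exists (P : A) (i1 : Z0 X P) (i2 : Z0 Y P)
      (p1 : Z0 P X) (p2 : Z0 P Y),
    [/\ homotopic (comp0 p1 i1) (id0 X),
        homotopic (comp0 p2 i2) (id0 Y),
        homotopic (comp0 p1 i2) 0,
        homotopic (comp0 p2 i1) 0 &
        homotopic (cval (comp0 i1 p1) + cval (comp0 i2 p2)) (id0 P)]).

Definition preabelian : Prop :=
  [/\ H0_additive,
      forall (Y Z : A) (g : Z0 Y Z), exists (X : A) (f : Z0 X Y)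
        (h : hom X Z (-1))
        (dh : cc_d (addNr 1) h = - cval (comp0 g f)),
        left_exact (Complex3 dh) &
      forall (X Y : A) (f : Z0 X Y), exists (Z : A) (g : Z0 Y Z)
        (h : hom X Z (-1))
        (dh : cc_d (addNr 1) h = - cval (comp0 g f)),
        right_exact (Complex3 dh)].

End DG.

(* The opposite DG-category, with g o^op f = (-1)^(|g||f|) f o g. *)
Section Opposite.
Variables (k : comPzRingType) (A : dgcat k).

Definition op_comp (X Y Z : A) (i j l : int) (e : i + j = l)
    (g : hom Z Y i) (f : hom Y X j) : hom Z X l :=
  sgk k (i * j) *: comp (etrans (addrC j i) e) f g.

Lemma op_linearr (X Y Z : A) (i j l : int) (e : i + j = l) (g : hom Z Y i) :
  linear (fun f : hom Y X j => op_comp e g f).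
Proof.
move=> a u v; rewrite /op_comp compDl compZl scalerDr !scalerA.
by rewrite (mulrC a).
Qed.

Lemma op_linearl (X Y Z : A) (i j l : int) (e : i + j = l) (f : hom Y X j) :
  linear (fun g : hom Z Y i => op_comp e g f).
Proof.
by move=> a u v; rewrite /op_comp linearP scalerDr !scalerA (mulrC a).
Qed.

Lemma op_assoc (X Y Z W : A) (a b c ab bc abc : int)
    (eab : a + b = ab) (ebc : b + c = bc)
    (el : ab + c = abc) (er : a + bc = abc)
    (h : hom W Z a) (g : hom Z Y b) (f : hom Y X c) :
  op_comp el (op_comp eab h g) f = op_comp er h (op_comp ebc g f).
Proof.
rewrite /op_comp linearZ /= compZl !scalerA -!sgkD.
rewrite -(comp_assoc (etrans (addrC c b) ebc) _ (etrans (addrC bc a) er)).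
by congr (sgk k _ *: _); subst; rewrite mulrDl mulrDr addrC addrA.
Qed.

Lemma op_idl (X Y : A) (i : int) (f : hom Y X i) :
  op_comp (add0r i) (idm Y) f = f.
Proof.
rewrite /op_comp mul0r scale1r (eq_irrelevance (etrans _ _) (addr0 i)).
exact: comp_idr.
Qed.

Lemma op_idr (X Y : A) (i : int) (f : hom Y X i) :
  op_comp (addr0 i) f (idm X) = f.
Proof.
rewrite /op_comp mulr0 scale1r (eq_irrelevance (etrans _ _) (add0r i)).
exact: comp_idl.
Qed.

Lemma op_leibniz (X Y Z : A) (i j l i' j' l' : int)
    (e : i + j = l) (el : l + 1 = l')
    (ei : i + 1 = i') (eg : i' + j = l')
    (ej : j + 1 = j') (ef : i + j' = l')
    (g : hom Z Y i) (f : hom Y X j) :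
  cc_d el (op_comp e g f) =
    op_comp eg (cc_d ei g) f + sgk k i *: op_comp ef g (cc_d ej f).
Proof.
rewrite /op_comp linearZ /=.
rewrite (comp_leibniz _ _ ej (etrans (addrC j' i) ef) ei (etrans (addrC j i') eg)).
have E1 : sgk k (i' * j) = sgk k (i * j) * sgk k j.
  by rewrite -ei mulrDl mul1r sgkD.
have E2 : sgk k i * sgk k (i * j') = sgk k (i * j).
  by rewrite -ej mulrDr mulr1 sgkD mulrCA sgk_sq mulr1.
by rewrite scalerDr !scalerA E1 E2; exact: addrC.
Qed.

Definition op : dgcat k :=
  @DGCat k A (fun X Y : A => hom Y X)
    op_comp (fun X : A => idm X) op_linearr op_linearl op_assoc op_idl op_idr
    op_leibniz (fun X Y i f => @hom_nonpos k A Y X i f).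

Lemma op_comp00 (X Y Z : A) (g : Z0 Y Z) (f : Z0 X Y) :
  (@comp0 k op Z Y X f g : hom X Z 0) = (comp0 g f : hom X Z 0).
Proof.
by rewrite /= /op_comp mul0r scale1r (eq_irrelevance (etrans _ _) (add0r 0)).
Qed.

(* Reversing the arrows exchanges the roles of B and A', of g and a', and of
   a and f; the homotopy s is unchanged. *)
Lemma op_square_ds (q : square A) :
  cc_d (addNr 1) (sqs q) =
    (@comp0 k op _ _ _ (sqa q) (sqf q) : hom (sqB q) (sqA' q) 0)
    - (@comp0 k op _ _ _ (sqg q) (sqa' q) : hom (sqB q) (sqA' q) 0).
Proof. by rewrite !op_comp00; exact: sqds. Qed.

Definition op_square (q : square A) : square op :=
  @Square k op (sqA' q) (sqB' q) (sqA q) (sqB q)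
    (sqa' q) (sqf q) (sqg q) (sqa q) (sqs q) (op_square_ds q).

Definition hcocartesian (q : square A) : Prop := hcartesian (op_square q).

Definition n_epi (n : nat) (X Y : A) (f : Z0 X Y) : Prop :=
  @n_mono k op n Y X f.

End Opposite.

Section Main.
Variables (k : comPzRingType) (A : dgcat k).

Definition abelian_truncated (n : nat) : Prop :=
  [/\ truncated A n,
      preabelian A,
      forall c : complex3 A,
        right_exact c -> n_mono n (c3f c) -> short_exact c &
      forall c : complex3 A,
        left_exact c -> n_epi n (c3g c) -> short_exact c].

Section Exact.
Variable S : complex3 A -> Prop.

Definition inflation (X Y : A) (f : Z0 X Y) : Prop :=
  exists (Z : A) (g : Z0 Y Z) (h : hom X Z (-1))
    (dh : cc_d (addNr 1) h = - cval (comp0 g f)),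
    S (Complex3 dh).

Definition deflation (Y Z : A) (g : Z0 Y Z) : Prop :=
  exists (X : A) (f : Z0 X Y) (h : hom X Z (-1))
    (dh : cc_d (addNr 1) h = - cval (comp0 g f)),
    S (Complex3 dh).

(* The class S of conflations is part of the data; its closure under
   isomorphism is required together with Ex0, Ex1, Ex2 and the dual of Ex2. *)
Record exact_dgcat : Prop := ExactDGCat {
  ex_iso : forall c c' : complex3 A, iso3 c c' -> S c -> S c';
  ex0 : forall X : A, deflation (id0 X);
  ex1 : forall (X Y Z : A) (g : Z0 Y Z) (f : Z0 X Y),
    deflation g -> deflation f -> deflation (comp0 g f);
  ex2_exists : forall (X Y Z : A) (f : Z0 X Z) (a' : Z0 Y Z), deflation f ->
    exists (B : A) (g : Z0 B Y) (a : Z0 B X) (s : hom B Z (-1))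
      (ds : cc_d (addNr 1) s = cval (comp0 f a) - cval (comp0 a' g)),
      hcartesian (Square ds);
  ex2_stable : forall q : square A,
    hcartesian q -> deflation (sqf q) -> deflation (sqg q);
  ex2'_exists : forall (X Y B : A) (a : Z0 B X) (g : Z0 B Y), inflation a ->
    exists (Z : A) (a' : Z0 Y Z) (f : Z0 X Z) (s : hom B Z (-1))
      (ds : cc_d (addNr 1) s = cval (comp0 f a) - cval (comp0 a' g)),
      hcocartesian (Square ds);
  ex2'_stable : forall q : square A,
    hcocartesian q -> inflation (sqa q) -> inflation (sqa' q)
}.

End Exact.
End Main.

(* Main.v *)
From mathcomp Require Import all_boot all_algebra.
From mathcomp Require Import zify.
Require Import Defs.

(* Since A is n-truncated, f is an n-monomorphism as soon as H^(1-n)(f o -) is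
   injective.  The long exact sequence of a homotopy kernel then shows that
   inflations are n-monomorphisms; conversely the homotopy cokernel of an
   n-monomorphism is a homotopy short exact sequence by abelianness.  Everything
   about deflations follows in the opposite category.

   The homotopy fibre product of f : X -> Z and a' : Y -> Z is the homotopy
   kernel K of phi = (f, -a') : X + Y -> Z.  If f is an n-epimorphism, so is phi,
   hence K -> X + Y -> Z is also right exact.  Let B be any homotopy fibre product
   of f and a', with projection g to Y.  If u : Y -> W has degree 1 - n and
   u g ~ 0, then u vanishes on K, which maps to B over Y, so by right exactness
   u p2 ~ v phi for some v : Z -> W.  Restricting to X gives 0 ~ v f, whence
   v ~ 0 and then u ~ 0: thus g is an n-epimorphism. *)

Set Implicit Arguments.
Unset Strict Implicit.
Unset Printing Implicit Defensive.

Import GRing.Theory.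
Local Open Scope ring_scope.

(** * Cohomology classes *)

Section Coboundary.
Variable k : comPzRingType.
Implicit Types M N : cochain k.

Definition cc_closed M i (x : M i) := cc_d (erefl (i + 1)) x = 0.

(** The primitive may sit in any degree [j] with [j + 1 = i], so none has to be cast; [coboundaryE]
    moves it to a prescribed degree. *)
Definition coboundary M i (x : M i) :=
  exists j (e : j + 1 = i) (w : M j), cc_d e w = x.

Lemma closed_d M i j (e : i + 1 = j) (x : M i) : cc_closed x -> cc_d e x = 0.
Proof. by subst j. Qed.

Lemma d_closed M i j (e : i + 1 = j) (x : M i) : cc_d e x = 0 -> cc_closed x.
Proof. by subst j. Qed.

Lemma coboundary_d M i j (e : j + 1 = i) (w : M j) : coboundary (cc_d e w).
Proof. by exists j, e, w. Qed.

Lemma coboundaryE M i j (e : j + 1 = i) (x : M i) :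
  coboundary x -> exists w : M j, cc_d e w = x.
Proof.
case=> j' [e' [w <-]].
have ej : j' = j by apply: (addIr 1); rewrite e e'.
by subst j'; exists w; rewrite (eq_irrelevance e e').
Qed.

Lemma coboundary0 M i : coboundary (0 : M i).
Proof. by rewrite -(linear0 (@cc_d k M _ _ (subrK 1 i))); apply: coboundary_d. Qed.

Lemma coboundaryD M i (x y : M i) :
  coboundary x -> coboundary y -> coboundary (x + y).
Proof.
case=> j [e [v <-]] /(coboundaryE e) [w <-].
by rewrite -linearD; apply: coboundary_d.
Qed.

Lemma coboundaryN M i (x : M i) : coboundary x -> coboundary (- x).
Proof. by case=> j [e [v <-]]; rewrite -linearN; apply: coboundary_d. Qed.

Lemma coboundaryB M i (x y : M i) :
  coboundary x -> coboundary y -> coboundary (x - y).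
Proof. by move=> cx /coboundaryN; apply: coboundaryD. Qed.

Lemma closedD M i (x y : M i) : cc_closed x -> cc_closed y -> cc_closed (x + y).
Proof. by rewrite /cc_closed linearD /= => -> ->; rewrite addr0. Qed.

Lemma closedB M i (x y : M i) : cc_closed x -> cc_closed y -> cc_closed (x - y).
Proof. by rewrite /cc_closed linearB /= => -> ->; rewrite subr0. Qed.

Lemma coboundary_sub M i (x y : M i) :
  coboundary (x - y) -> coboundary x <-> coboundary y.
Proof.
move=> cxy; split=> [cx|cy]; last by rewrite -(subrK y x); apply: coboundaryD.
by rewrite -[y](subKr x); apply: coboundaryB.
Qed.

Lemma cohomologousE M i (x y : M i) : cohomologous x y <-> coboundary (x - y).
Proof. by split=> [[w <-]|/coboundaryE]; [apply: coboundary_d | apply]. Qed.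

Lemma H_zeroE M i :
  H_zero M i <-> forall x : M i, cc_closed x -> coboundary x.
Proof.
split=> [M0 x cx|M0 x].
  by have /cohomologousE := M0 (Cocycle cx); rewrite subr0.
by apply/cohomologousE; rewrite subr0; apply: M0; apply: cclosed.
Qed.

Variables (M N : cochain k) (phi : chain_map M N).

Lemma cm_closed i (x : M i) : cc_closed x -> cc_closed (phi i x).
Proof. by rewrite /cc_closed -cm_d => ->; rewrite linear0. Qed.

Lemma cm_coboundary i (x : M i) : coboundary x -> coboundary (phi i x).
Proof. by case=> j [e [w <-]]; rewrite cm_d; apply: coboundary_d. Qed.

Lemma H_injE i : H_inj phi i <->
  forall x : M i, cc_closed x -> coboundary (phi i x) -> coboundary x.
Proof.
split=> [phi_inj x cx phix|phi_inj x y /cohomologousE].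
  have := phi_inj (Cocycle cx) (Cocycle (linear0 _)).
  by rewrite !cohomologousE /= linear0 !subr0; apply.
rewrite -linearB => /phi_inj h; apply/cohomologousE; apply: h.
by apply: closedB; apply: cclosed.
Qed.

Lemma H_surjE i : H_surj phi i <->
  forall y : N i, cc_closed y ->
    exists2 x : M i, cc_closed x & coboundary (phi i x - y).
Proof.
split=> [phi_surj y cy|phi_surj y].
  have [x /cohomologousE phix] := phi_surj (Cocycle cy).
  by exists (cval x); first exact: cclosed.
have [x cx phix] := phi_surj _ (cclosed y).
by exists (Cocycle cx); apply/cohomologousE.
Qed.

End Coboundary.

Section Transfer.
Variable k : comPzRingType.

(** On H^i the square commutes and the opposite sides [ga] and [F] are invertible, so [L] and [L']
    are bijective together. The diagram chase runs on representatives. *)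
Lemma H_bij_square (P Q P' Q' : cochain k) (L : chain_map P Q)
    (L' : chain_map P' Q') (ga : chain_map P P') (F : chain_map Q Q') (i : int) :
  (forall x : P i, cc_closed x -> coboundary (L' i (ga i x) - F i (L i x))) ->
  H_bij ga i -> H_bij F i -> H_bij L i <-> H_bij L' i.
Proof.
move=> sq [/H_injE ga_inj /H_surjE ga_surj] [/H_injE F_inj /H_surjE F_surj].
split=> [] [/H_injE L_inj /H_surjE L_surj]; split.
- apply/H_injE => x' cx' L'x'; have [x cx gax] := ga_surj x' cx'.
  apply/(coboundary_sub gax)/cm_coboundary/L_inj => //.
  apply: F_inj; first exact: cm_closed.
  apply/(coboundary_sub (sq x cx)).
  have L'ga : coboundary (L' i (ga i x) - L' i x').
    by rewrite -linearB; apply: cm_coboundary.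
  exact/(coboundary_sub L'ga).
- apply/H_surjE => y' cy'; have [y cy Fy] := F_surj y' cy'.
  have [x cx Lx] := L_surj y cy.
  exists (ga i x); first exact: cm_closed.
  rewrite -(subrKA (F i (L i x))) -[X in _ + X](subrKA (F i y)).
  apply: coboundaryD; first exact: sq.
  by apply: coboundaryD => //; rewrite -linearB; apply: cm_coboundary.
- apply/H_injE => x cx Lx; apply: ga_inj => //.
  apply: L_inj; first exact: cm_closed.
  by apply/(coboundary_sub (sq x cx))/cm_coboundary.
- apply/H_surjE => y cy; have [x' cx' Lx'] := L_surj _ (cm_closed F cy).
  have [x cx gax] := ga_surj x' cx'; exists x => //.
  apply: F_inj; first by apply: closedB => //; apply: cm_closed.
  (* Injectivity of H^i(F) reduces the claim to this element, which splits into the errors of the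
     lifts [x'] and [x] and the defect of the square. *)
  have -> : F i (L i x - y) = (L' i x' - F i y) + L' i (ga i x - x')
      - (L' i (ga i x) - F i (L i x)).
    rewrite (linearB (F i)) (linearB (L' i)) /= opprB.
    by rewrite [RHS]addrC [_ - _ + (_ - L' _ _)]addrC !subrKA.
  apply: coboundaryB; last exact: sq.
  by apply: coboundaryD => //; apply: cm_coboundary.
Qed.
End Transfer.

(** * Fibres of chain maps *)

Section FibCohomology.
Variables (k : comPzRingType) (M N : cochain k) (phi : chain_map M N).

Lemma fib_closedE i (x : Fib phi i) :
  cc_closed x <-> cc_closed x.1 /\ cc_d (subrK 1 i) x.2 = - phi i x.1.
Proof.
case: x => m p; rewrite /cc_closed /= /Fib_d /=.
have -> : cc_d (fib_deg' erefl) p = degcast (fib_deg erefl) (cc_d (subrK 1 i) p).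
  case: _ / (fib_deg erefl) (fib_deg' erefl) => e.
  by rewrite (eq_irrelevance (subrK 1 i) e).
rewrite -(linearN (degcast _)) -(linearB (degcast _)) /=.
have cast0 : degcast (fib_deg (erefl (i + 1))) (- phi i m - cc_d (subrK 1 i) p) = 0
    <-> - phi i m - cc_d (subrK 1 i) p = 0.
  by case: _ / (fib_deg (erefl (i + 1))).
split=> [[dm /cast0/eqP]|[dm dp]].
  by rewrite subr_eq0 => /eqP ->.
congr pair => //; apply/cast0; rewrite dp; exact: subrr.
Qed.

(** If d(m', p') = (m, p), then p + phi m' = - d p', so p' enters only through a coboundary
    condition in [N]. *)
Lemma fib_coboundaryE i (x : Fib phi i) : coboundary x <->
  exists2 m : M (i - 1), cc_d (subrK 1 i) m = x.1 & coboundary (x.2 + phi _ m).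
Proof.
case: x => m p /=; split=> [/(coboundaryE (subrK 1 i)) [[m' p'] [<- <-]]|].
  exists m' => //=; rewrite degcast_id addrAC addNr add0r.
  by apply/coboundaryN/coboundary_d.
case=> m' <- /(coboundaryE (fib_deg' (subrK 1 i))) [p' dp'].
exists (i - 1), (subrK 1 i), (m', - p'); congr pair.
by rewrite degcast_id linearN /= dp' opprK [LHS]addrC addrK.
Qed.

End FibCohomology.

Section FibMap.
Variables (k : comPzRingType) (M N M' N' : cochain k).
Variables (phi : chain_map M N) (phi' : chain_map M' N').
Variables (al : chain_map M M') (be : chain_map N N').
Variable eta : forall i j : int, j + 1 = i -> M i -> N' j.
Hypothesis eta_linear : forall i j (e : j + 1 = i), linear (eta e).
Hypothesis eta_d : forall i j l (e : j + 1 = i) (e' : i + 1 = l) (x : M i),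
  be i (phi i x) - phi' i (al i x) = eta e' (cc_d e' x) + cc_d e (eta e x).

(** A square of chain maps that commutes up to homotopy induces a map of fibres; the homotopy [eta]
    corrects the second coordinate so that differentials are respected. *)
Definition fib_map_fun (i : int) (x : Fib phi i) : Fib phi' i :=
  (al i x.1, be (i - 1) x.2 + eta (subrK 1 i) x.1).

Lemma fib_map_linear i : linear (@fib_map_fun i).
Proof.
move=> a [x1 x2] [y1 y2]; rewrite /fib_map_fun /= !linearP eta_linear.
by congr pair; rewrite /= scalerDr addrACA.
Qed.

Lemma fib_map_d i j (e : i + 1 = j) (x : Fib phi i) :
  fib_map_fun (cc_d e x) = cc_d e (fib_map_fun x).
Proof.
case: x => m p; rewrite /fib_map_fun /= /Fib_d /= cm_d; congr pair.
have be_cast i' j' (c : i' = j') z : be j' (degcast c z) = degcast c (be i' z).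
  by case: _ / c.
have eta_cast : eta (subrK 1 j) (cc_d e m) = degcast (fib_deg e) (eta e (cc_d e m)).
  by case: _ / (fib_deg e) (subrK 1 j) => e'; rewrite (eq_irrelevance e e').
have d_cast : cc_d (fib_deg' e) (eta (subrK 1 i) m)
    = degcast (fib_deg e) (cc_d (subrK 1 i) (eta (subrK 1 i) m)).
  by case: _ / (fib_deg e) (fib_deg' e) => e'; rewrite (eq_irrelevance (subrK 1 i) e').
rewrite linearB linearN /= be_cast cm_d eta_cast linearD /= d_cast.
rewrite addrAC [X in _ = _ - X]addrC opprD addrA; congr (_ - _).
apply/eqP; rewrite -subr_eq0 opprD !opprK addrACA.
rewrite -(linearN (degcast _)) -!(linearD (degcast _)) /= -eta_d.
by rewrite addrACA addNr subrr addr0 linear0.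
Qed.

Definition fib_map : chain_map (Fib phi) (Fib phi') :=
  ChainMap fib_map_linear fib_map_d.

(* The five lemma for the long exact sequences of the two fibres. *)
Lemma fib_map_bij i :
  H_bij al i -> H_surj al (i - 1) -> H_inj be i -> H_bij be (i - 1) ->
  H_bij fib_map i.
Proof.
move=> [/H_injE al_inj /H_surjE al_surj] /H_surjE al_surj'.
move=> /H_injE be_inj [/H_injE be_inj' /H_surjE be_surj].
split.
- apply/H_injE => -[m p] /fib_closedE [/= dm dp] /fib_coboundaryE [/= m' dm' cp].
  have /al_inj/(coboundaryE (subrK 1 i)) [//|m1 dm1] : coboundary (al i m).
    by rewrite -dm'; apply: coboundary_d.
  (* The primitive [m1] of [m] may be changed by a cocycle; [m2] is chosen so that [al (m1 + m2)] is
     cohomologous to [m']. *)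
  have [|m2 dm2 cm2] := al_surj' (m' - al (i - 1) m1).
    by apply: (d_closed (e := subrK 1 i)); rewrite linearB /= -cm_d dm1 dm' subrr.
  apply/fib_coboundaryE; exists (m1 + m2) => /=.
    by rewrite linearD /= dm1 (closed_d _ dm2) addr0.
  apply: be_inj'.
    apply: (d_closed (e := subrK 1 i)).
    by rewrite linearD /= -cm_d dp linearD /= dm1 (closed_d _ dm2) addr0 addNr.
  have := eta_d (subrK 1 (i - 1)) (subrK 1 i) (m1 + m2).
  rewrite [cc_d _ (_ + _)]linearD /= dm1 (closed_d _ dm2) addr0 => eta_m.
  (* The first three terms form a coboundary by [cp], the fourth is the image of one by [cm2], and
     the last is a differential. *)
  have -> : be (i - 1) (p + phi (i - 1) (m1 + m2)) =
      be (i - 1) p + eta (subrK 1 i) m + phi' (i - 1) m'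
      + phi' (i - 1) (al (i - 1) m2 - (m' - al (i - 1) m1))
      + cc_d (subrK 1 (i - 1)) (eta (subrK 1 (i - 1)) (m1 + m2)).
    have -> : al (i - 1) m2 - (m' - al (i - 1) m1) = al (i - 1) (m1 + m2) - m'.
      by rewrite (linearD (al _)) opprB addrCA addrA.
    rewrite (linearB (phi' _)) (linearD (be _)) /= -!addrA; congr (_ + _).
    rewrite -(subrK (phi' _ (al _ (m1 + m2))) (be _ (phi _ _))) eta_m.
    by rewrite [phi' _ m' + _]addrCA addNKr [RHS]addrCA [RHS]addrC.
  by do 2?apply: coboundaryD => //; [apply: cm_coboundary | apply: coboundary_d].
- apply/H_surjE => -[m' p'] /fib_closedE [/= dm' dp'].
  have [m dm /(coboundaryE (subrK 1 i)) [q dq]] := al_surj m' dm'.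
  have := eta_d (subrK 1 i) erefl m; rewrite dm.
  have -> : eta erefl (0 : M (i + 1)) = 0.
    have := eta_linear (erefl (i + 1)) (-1) 0 0.
    by rewrite scaler0 addr0 scaleN1r addNr.
  rewrite add0r => /eqP; rewrite subr_eq => /eqP be_phi.
  (* Up to coboundaries, be (phi m) is phi' (al m), hence phi' m', which is - d p'. *)
  have /be_inj/(coboundaryE (subrK 1 i)) [|n dn] : coboundary (be i (phi i m)).
    rewrite be_phi -(subrK m' (al i m)) -dq linearD /= cm_d.
    apply: coboundaryD; first exact: coboundary_d.
    apply: coboundaryD; first exact: coboundary_d.
    by rewrite -[phi' i m']opprK -dp'; apply/coboundaryN/coboundary_d.
  - exact: cm_closed.
  (* The pair (m, - n) is a cocycle of the fibre. Once [q] has matched the first coordinates, its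
     image misses (m', p') by - r in the second; a cocycle [n'] whose image is cohomologous to [r]
     repairs this. *)
  set r := be (i - 1) n - eta (subrK 1 i) m + p' - phi' (i - 1) q.
  have [|n' dn' cn'] := be_surj r.
    apply: (d_closed (e := subrK 1 i)).
    rewrite /r !linearB linearD /= linearB /= -!cm_d dn dq be_phi addrAC dp' .
    by rewrite [_ + phi' _ _]addrC addrK (linearB (phi' i)) /= subKr subrr.
  exists (m, n' - n).
    apply/fib_closedE; split => //=.
    by rewrite linearB /= (closed_d _ dn') dn add0r.
  apply/fib_coboundaryE; exists q => //=.
  suff -> : be (i - 1) (n' - n) + eta (subrK 1 i) m - p' + phi' (i - 1) q
    = be (i - 1) n' - r by [].
  by rewrite linearB /= /r !opprD !opprK -!addrA.
Qed.
End FibMap.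

(** * Homotopy invariance of exactness *)

Section Homotopy.
Variables (k : comPzRingType) (A : dgcat k).

Lemma compBl (X Y Z : A) (i j l : int) (e : i + j = l) (g g' : hom Y Z i)
    (f : hom X Y j) : comp e (g - g') f = comp e g f - comp e g' f.
Proof. by rewrite compDl compNl. Qed.

Lemma comp_coboundaryl (X Y Z : A) (i j l : int) (e : i + j = l)
    (g : hom Y Z i) (f : hom X Y j) :
  coboundary g -> cc_closed f -> coboundary (comp e g f).
Proof.
case=> i' [ei [w <-]] cf.
have el : (i' + j) + 1 = l by rewrite -e -ei addrAC.
have := comp_leibniz (erefl (i' + j)) el ei e (erefl (j + 1)) (etrans (addrA _ _ _) el) w f.
by rewrite [cc_d erefl f]cf comp0r scaler0 addr0 => <-; apply: coboundary_d.
Qed.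

Lemma comp_coboundaryr (X Y Z : A) (i j l : int) (e : i + j = l)
    (g : hom Y Z i) (f : hom X Y j) :
  cc_closed g -> coboundary f -> coboundary (comp e g f).
Proof.
move=> cg [j' [ej [w <-]]].
have el : (i + j') + 1 = l by rewrite -e -ej addrA.
have := comp_leibniz (erefl (i + j')) el (erefl (i + 1)) (etrans (addrAC _ _ _) el) ej e g w.
rewrite [cc_d erefl g]cg comp0l add0r => d_gw.
(* The Leibniz rule leaves a sign (-1)^i on this side; multiplying by its square absorbs it into the
   primitive. *)
rewrite -[comp e _ _]scale1r -(sgk_sq k i) -scalerA -d_gw -linearZ.
exact: coboundary_d.
Qed.

Lemma homotopicE (X Y : A) (f g : hom X Y 0) :
  homotopic f g <-> coboundary (f - g).
Proof. exact: cohomologousE. Qed.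

Lemma post_comp0 (X Y Z W : A) (g : Z0 Y Z) (f : Z0 X Y) i (u : hom W X i) :
  postcomp (comp0 g f) W i u = postcomp g W i (postcomp f W i u).
Proof. exact: comp_assoc. Qed.

Lemma post_id (X W : A) i (u : hom W X i) : postcomp (id0 X) W i u = u.
Proof. exact: comp_idl. Qed.

Lemma pre_comp0 (X Y Z W : A) (g : Z0 Y Z) (f : Z0 X Y) i (u : hom Z W i) :
  precomp (comp0 g f) W i u = precomp f W i (precomp g W i u).
Proof. by rewrite /= /pre_fun (comp_assoc (addr0 i) (add0r 0) (addr0 i) (addr0 i)). Qed.

Lemma pre_id (X W : A) i (u : hom X W i) : precomp (id0 X) W i u = u.
Proof. exact: comp_idr. Qed.

Lemma post_homotopic (X Y W : A) (f g : Z0 X Y) i (u : hom W X i) :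
  homotopic f g -> cc_closed u -> coboundary (postcomp f W i u - postcomp g W i u).
Proof.
by move=> /homotopicE fg cu; rewrite /= /post_fun -compBl; apply: comp_coboundaryl.
Qed.

Lemma pre_homotopic (X Y W : A) (f g : Z0 X Y) i (u : hom Y W i) :
  homotopic f g -> cc_closed u -> coboundary (precomp f W i u - precomp g W i u).
Proof.
move=> /homotopicE fg cu; rewrite /= /pre_fun -linearB /=.
exact: comp_coboundaryr.
Qed.

Lemma hequiv_bij (X Y W : A) (f : Z0 X Y) i : hequiv f -> H_bij (postcomp f W) i.
Proof.
case=> g [gf fg]; split.
  apply/H_injE => u cu cfu.
  have := post_homotopic gf cu; rewrite post_comp0 post_id => h.
  by apply/(coboundary_sub h)/cm_coboundary.
apply/H_surjE => v cv; exists (postcomp g W i v); first exact: cm_closed.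
by have := post_homotopic fg cv; rewrite post_comp0 post_id.
Qed.

Section Iso3.
Variables (c c' : complex3 A) (m : mor3 c c') (W : A).

Lemma pred_deg (i j : int) : j + 1 = i -> -1 + i = j.
Proof. by move=> <-; rewrite addrC addrK. Qed.

(** Here s' bounds g'y - zg, whereas [fib_map] asks for a homotopy bounding zg - g'y; hence the
    sign. *)
Definition iso3_eta (i j : int) (e : j + 1 = i) (u : hom W (c3Y c) i) :
    hom W (c3Z c') j :=
  - comp (pred_deg e) (m3s' m) u.

Lemma iso3_eta_linear i j (e : j + 1 = i) : linear (iso3_eta e).
Proof. by move=> a u v; rewrite /iso3_eta linearP opprD scalerN. Qed.

Lemma iso3_eta_d i j l (e : j + 1 = i) (e' : i + 1 = l) (u : hom W (c3Y c) i) :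
  postcomp (m3z m) W i (postcomp (c3g c) W i u)
    - postcomp (c3g c') W i (postcomp (m3y m) W i u)
  = iso3_eta e' (cc_d e' u) + cc_d e (iso3_eta e u).
Proof.
rewrite -!post_comp0 /= /post_fun -compBl /iso3_eta linearN /=.
rewrite (comp_leibniz _ e (addNr 1) (add0r i) e' (pred_deg e')) m3ds'.
by rewrite /sgk expr1 scaleN1r opprD opprK [RHS]addrC addrK -[RHS]compNl opprB.
Qed.

Definition iso3_fib := fib_map iso3_eta_linear iso3_eta_d.

(** The element s u bounds the difference f'xu - yfu of first coordinates, and what then remains in
    the second is - d(t) u. *)
Lemma iso3_fib_square i (u : hom W (c3X c) i) : cc_closed u ->
  coboundary (left_cmp c' W i (postcomp (m3x m) W i u)
              - iso3_fib i (left_cmp c W i u)).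
Proof.
move=> cu; apply/fib_coboundaryE.
exists (comp (addrC (-1) i) (m3s m) u).
  rewrite (comp_leibniz _ _ (addNr 1) (add0r i) (erefl (i + 1)) (pred_deg (erefl (i + 1)))).
  rewrite [cc_d erefl u]cu comp0r scaler0 addr0 m3ds compBl.
  by congr (_ - _); apply: (comp_assoc (add0r 0) (add0r i) (add0r i) (add0r i)).
rewrite /= /iso3_eta /post_fun.
rewrite -!(comp_assoc (addr0 (-1)) _ (addrC (-1) i)).
rewrite -!(comp_assoc (add0r (-1)) (addrC (-1) i) (addrC (-1) i)).
have -> : forall a b c d : hom W (c3Z c') (i - 1),
  a - (b - c) + d = - (b - c - d - a).
  by move=> *; rewrite [RHS]opprB -addrA; congr (_ + _); rewrite [RHS]opprD opprK.
rewrite -!compBl -m3dt.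
apply/coboundaryN/comp_coboundaryl => //; exact: coboundary_d.
Qed.
End Iso3.

(** The two comparison maps are opposite sides of a square commuting up to coboundaries. The other
    sides are composition with x and the map of fibres given by y, z and s'; the latter is bijective
    on cohomology by the five lemma. *)
Lemma iso3_left_exact (c c' : complex3 A) :
  iso3 c c' -> left_exact c <-> left_exact c'.
Proof.
case=> m [ex ey ez].
suff bij W i : H_bij (left_cmp c W) i <-> H_bij (left_cmp c' W) i.
  by split=> ec W i /(ec W)/bij.
apply: H_bij_square; [exact: iso3_fib_square | exact: hequiv_bij |].
have [_ surj_y] := hequiv_bij W (i - 1) ey; have [inj_z _] := hequiv_bij W i ez.
by apply: fib_map_bij => //; apply: hequiv_bij.
Qed.

End Homotopy.

(** * n-monomorphisms and fibre products *)

Section Mono.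
Variables (k : comPzRingType) (A : dgcat k) (n : nat).
Hypothesis trA : truncated A n.

Lemma truncated_coboundary (X Y : A) (i : int) (u : hom X Y i) :
  i <= - n%:Z -> cc_closed u -> coboundary u.
Proof. by move=> /trA/H_zeroE; apply. Qed.

(* In degrees at most -n source and target have no cohomology. *)
Lemma n_monoE (X Y : A) (f : Z0 X Y) : n_mono n f <->
  forall (W : A) (u : hom W X (- n%:Z + 1)),
    cc_closed u -> coboundary (postcomp f W _ u) -> coboundary u.
Proof.
split=> [fm W|fm W]; first by have [/H_injE] := fm W.
split; first exact/H_injE/fm.
move=> i lein; split; first by apply/H_injE => u cu _; apply: truncated_coboundary.
apply/H_surjE => v cv; exists 0; first exact: linear0.
rewrite linear0 sub0r; exact/coboundaryN/truncated_coboundary.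
Qed.

Lemma n_mono_id (X : A) : n_mono n (id0 X).
Proof. by apply/n_monoE => W u cu; rewrite post_id. Qed.

(** If f u = d w, then (f u, h u) is a boundary in the fibre of g as soon as h u + g w is one in
    A(W, Z). That element is a cocycle of degree - n, so truncation applies. *)
Lemma left_exact_n_mono (c : complex3 A) :
  (0 < n)%N -> left_exact c -> n_mono n (c3f c).
Proof.
move=> n_gt0 lc; apply/n_monoE => W u cu.
case/(coboundaryE (subrK 1 _)) => w dw.
(* Positivity of [n] puts the degree 1 - n in the range i <= 0 covered by left exactness. *)
have [|/H_injE inj _] := lc W (- n%:Z + 1); first by lia.
apply: inj => //; apply/fib_coboundaryE; exists w => //.
apply: truncated_coboundary; first by rewrite addrK.
apply: (d_closed (e := subrK 1 _)); rewrite linearD /= -(cm_d (postcomp _ _)) dw.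
have /fib_closedE [_ /= ->] := cm_closed (left_cmp c W) cu.
exact: addNr.
Qed.

End Mono.

Section Biproduct.
Variables (k : comPzRingType) (A : dgcat k) (X Y P : A).
Variables (i1 : Z0 X P) (i2 : Z0 Y P) (p1 : Z0 P X) (p2 : Z0 P Y).

Definition is_biproduct :=
  [/\ homotopic (comp0 p1 i1) (id0 X), homotopic (comp0 p2 i2) (id0 Y),
      homotopic (comp0 p1 i2) 0, homotopic (comp0 p2 i1) 0 &
      homotopic (cval (comp0 i1 p1) + cval (comp0 i2 p2)) (id0 P)].

Lemma cospan_closed (Z : A) (f : Z0 X Z) (a' : Z0 Y Z) :
  cc_d (erefl (0 + 1)) (cval (comp0 f p1) - cval (comp0 a' p2)) = 0.
Proof. by apply: closedB; apply: cclosed. Qed.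

Definition copair (Z : A) (f : Z0 X Z) (a' : Z0 Y Z) : Z0 P Z :=
  Cocycle (cospan_closed f a').

Lemma post_copair (Z W : A) (f : Z0 X Z) (a' : Z0 Y Z) i (u : hom W P i) :
  postcomp (copair f a') W i u =
  postcomp f W i (postcomp p1 W i u) - postcomp a' W i (postcomp p2 W i u).
Proof. by rewrite -!post_comp0 /= /post_fun compBl. Qed.

Lemma pre_copair (Z W : A) (f : Z0 X Z) (a' : Z0 Y Z) i (u : hom Z W i) :
  precomp (copair f a') W i u =
  precomp p1 W i (precomp f W i u) - precomp p2 W i (precomp a' W i u).
Proof. by rewrite -!pre_comp0 /= /pre_fun linearB. Qed.

Definition proj_fun (W : A) (i : int) (u : hom W P i) : dsum (hom W X) (hom W Y) i :=
  (postcomp p1 W i u, postcomp p2 W i u).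

Lemma proj_linear W i : linear (@proj_fun W i).
Proof. by move=> a u v; rewrite /proj_fun (linearP (postcomp p1 W i)) (linearP (postcomp p2 W i)). Qed.

Lemma proj_d W i j (e : i + 1 = j) (u : hom W P i) :
  proj_fun (cc_d e u) = cc_d e (proj_fun u).
Proof. by rewrite /proj_fun !cm_d. Qed.

Definition proj_map W := ChainMap (@proj_linear W) (@proj_d W).

Hypothesis bip : is_biproduct.

(** The biproduct identities hold in H^0, but composing their homotopies with a cocycle of degree i
    gives coboundaries of degree i, so the splitting persists in every degree. *)
Lemma proj_map_bij W i : H_bij (proj_map W) i.
Proof.
case: bip => e11 e22 e12 e21 e1; split.
  apply/H_injE => u cu [j [e [[w1 w2] [dw1 dw2]]]].
  have h : coboundary (postcomp i1 W i (postcomp p1 W i u)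
                       + postcomp i2 W i (postcomp p2 W i u) - u).
    move/homotopicE in e1.
    by have := comp_coboundaryl (add0r i) e1 cu; rewrite compBl compDl comp_idl
      -!post_comp0.
  apply/(coboundary_sub h)/coboundaryD; apply: cm_coboundary.
    by have := coboundary_d e w1; rewrite dw1.
  by have := coboundary_d e w2; rewrite dw2.
apply/H_surjE => -[u v] [cu cv].
have h12 : coboundary (postcomp p1 W i (postcomp i2 W i v)).
  move/homotopicE: e12; rewrite subr0 => e12'.
  by have := comp_coboundaryl (add0r i) e12' cv; rewrite -post_comp0.
have h21 : coboundary (postcomp p2 W i (postcomp i1 W i u)).
  move/homotopicE: e21; rewrite subr0 => e21'.
  by have := comp_coboundaryl (add0r i) e21' cu; rewrite -post_comp0.
have [h11 h22] := (post_homotopic e11 cu, post_homotopic e22 cv).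
rewrite post_comp0 post_id in h11; rewrite post_comp0 post_id in h22.
exists (postcomp i1 W i u + postcomp i2 W i v).
  by apply: closedD; apply: cm_closed.
have [w1 dw1] : exists w, cc_d (subrK 1 i) w =
    postcomp p1 W i (postcomp i1 W i u + postcomp i2 W i v) - u.
  apply: coboundaryE; rewrite (linearD (postcomp p1 W i)) /= addrAC.
  exact: coboundaryD.
have [w2 dw2] : exists w, cc_d (subrK 1 i) w =
    postcomp p2 W i (postcomp i1 W i u + postcomp i2 W i v) - v.
  apply: coboundaryE; rewrite (linearD (postcomp p2 W i)) /= -addrA.
  exact: coboundaryD.
by exists (i - 1), (subrK 1 i), (w1, w2); congr pair.
Qed.

Section KernelCartesian.
Variables (Z K : A) (f : Z0 X Z) (a' : Z0 Y Z) (kap : Z0 K P) (h : hom K Z (-1)).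
Variable dh : cc_d (addNr 1) h = - cval (comp0 (copair f a') kap).

(** Complexes carry d(h) = - phi kap and squares d(s) = f a - a' g, so the homotopy of the square is
    - h. *)
Lemma kernel_square_d : cc_d (addNr 1) (- h) =
  cval (comp0 f (comp0 p1 kap)) - cval (comp0 a' (comp0 p2 kap)).
Proof.
rewrite linearN /= dh opprK; have := post_copair f a' (cval kap).
by [].
Qed.

(** Splitting A(W, P) by the projections identifies, on cohomology, the fibre of phi o - with that
    of the cospan. The square of chain maps behind this commutes strictly, so [fib_map] is used with
    the zero homotopy. *)
Lemma kernel_cartesian : left_exact (Complex3 dh) ->
  hcartesian (Square kernel_square_d).
Proof.
move=> lK W i i_le0.
have id_equiv (V : A) : hequiv (id0 V).
  by exists (id0 V); split; apply/homotopicE; rewrite /= comp_idl subrr; apply: coboundary0.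
have id_bij (V : A) j : H_bij (postcomp (id0 V) W) j by apply: hequiv_bij.
have zero_linear (j l : int) (e : l + 1 = j) : linear (fun _ : hom W P j => 0 : hom W Z l).
  by move=> b u v; rewrite scaler0 addr0.
have zero_d j l l' (e : l + 1 = j) (e' : j + 1 = l') (u : hom W P j) :
  postcomp (id0 Z) W j (postcomp (copair f a') W j u)
    - cospan_map (Square kernel_square_d) W j (proj_map W j u) = 0 + cc_d e (0 : hom W Z l).
  by rewrite linear0 addr0 post_id post_copair; apply: subrr.
have [_ surj_p] := proj_map_bij W (i - 1); have [inj_z _] := id_bij Z i.
have F_bij := fib_map_bij zero_linear zero_d (proj_map_bij W i) surj_p inj_z (id_bij Z _).
apply/(H_bij_square (L := left_cmp (Complex3 dh) W) _ (id_bij K i) F_bij); last exact: lK.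
move=> u cu; rewrite post_id.
suff -> : square_cmp (Square kernel_square_d) W i u =
    fib_map zero_linear zero_d i (left_cmp (Complex3 dh) W i u).
  by rewrite subrr; apply: coboundary0.
rewrite /= /square_fun /fib_map_fun /= addr0 compNl opprK /post_fun comp_idl.
by congr (pair (pair _ _) _); apply: (comp_assoc (add0r 0) (add0r i) (add0r i) (add0r i)).
Qed.
End KernelCartesian.

End Biproduct.

(** * Duality *)

(** The two fibres share their modules, but their differentials are not convertible. Cocycles and
    coboundaries depend only on the values of [phi], so bijectivity transfers; this serves to
    compare a category with its opposite. *)
Lemma fib_bij_ext (k : comPzRingType) (P M N : cochain k)
    (phi phi' : chain_map M N) (L : chain_map P (Fib phi))
    (L' : chain_map P (Fib phi')) (i : int) :
  (forall j (x : M j), phi j x = phi' j x) ->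
  (forall x : P i, L i x = L' i x :> Fib_obj M N i) ->
  H_bij L i <-> H_bij L' i.
Proof.
move=> ephi eL.
have ecl (y : Fib_obj M N i) :
    cc_closed (y : Fib phi i) <-> cc_closed (y : Fib phi' i).
  by rewrite !fib_closedE ephi.
have ecob (y : Fib_obj M N i) :
    coboundary (y : Fib phi i) <-> coboundary (y : Fib phi' i).
  by rewrite !fib_coboundaryE; split=> -[m dm cm]; exists m => //; move: cm; rewrite ephi.
rewrite /H_bij !H_injE !H_surjE; split=> -[inj surj]; split.
- by move=> x cx Lx; apply: inj => //; apply/ecob; rewrite eL.
- move=> y /ecl/surj [x cx Lx]; exists x => //; apply/ecob.
  by move: Lx; rewrite eL.
- by move=> x cx Lx; apply: inj => //; apply/ecob; move: Lx; rewrite eL.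
- move=> y /ecl/surj [x cx Lx]; exists x => //; apply/ecob.
  by rewrite eL.
Qed.

Section OppositeExact.
Variables (k : comPzRingType) (A : dgcat k).

Lemma op_post (X Y W : A) (f : Z0 X Y) i (u : hom Y W i) :
  @postcomp k (op A) Y X f W i u = precomp f W i u.
Proof.
rewrite /= /post_fun /= /op_comp mul0r scale1r.
by rewrite (eq_irrelevance (etrans _ _) (addr0 i)).
Qed.

Lemma op_pre (X Y W : A) (f : Z0 X Y) i (u : hom W X i) :
  @precomp k (op A) Y X f W i u = postcomp f W i u.
Proof.
rewrite /= /pre_fun /= /op_comp mulr0 scale1r.
by rewrite (eq_irrelevance (etrans _ _) (add0r i)).
Qed.

Section Complex.
Variables (X Y Z : A) (f : Z0 X Y) (g : Z0 Y Z) (h : hom X Z (-1)).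
Variable dh : cc_d (addNr 1) h = - cval (comp0 g f).

Lemma op_complex_d : cc_d (addNr 1) (h : @hom k (op A) Z X (-1)) =
  - cval (@comp0 k (op A) Z Y X f g).
Proof. by rewrite op_comp00. Qed.

Variable dh' : cc_d (addNr 1) (h : @hom k (op A) Z X (-1)) =
  - cval (@comp0 k (op A) Z Y X f g).

Lemma op_left_exact :
  @left_exact k (op A) (@Complex3 k (op A) Z Y X g f h dh')
  <-> right_exact (Complex3 dh).
Proof.
suff bij W i : H_bij (@left_cmp k (op A) (@Complex3 k (op A) Z Y X g f h dh') W) i
    <-> H_bij (right_cmp (Complex3 dh) W) i.
  by split=> ex W i /(ex W)/bij.
apply: fib_bij_ext => [j u|u]; first exact: op_post.
congr pair; first exact: op_post.
(* The Koszul sign of the opposite in degrees -1 and i is exactly the (-1)^i of [right_fun]. *)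
rewrite /= /op_comp mulN1r /sgk abszN.
by rewrite (eq_irrelevance (etrans _ _) (erefl (i - 1))).
Qed.

Lemma op_right_exact :
  @right_exact k (op A) (@Complex3 k (op A) Z Y X g f h dh')
  <-> left_exact (Complex3 dh).
Proof.
suff bij W i : H_bij (@right_cmp k (op A) (@Complex3 k (op A) Z Y X g f h dh') W) i
    <-> H_bij (left_cmp (Complex3 dh) W) i.
  by split=> ex W i /(ex W)/bij.
apply: fib_bij_ext => [j u|u]; first exact: op_pre.
congr pair; first exact: op_pre.
(* Here the Koszul sign cancels the one built into [right_fun]. *)
rewrite /= /op_comp mulrN1 scalerA {2}/sgk abszN sgk_sq scale1r.
by rewrite (eq_irrelevance (etrans _ _) (addrC (-1) i)).
Qed.

End Complex.

Variable n : nat.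

Lemma op_truncated : truncated A n -> truncated (op A) n.
Proof. by move=> trA X Y; apply: trA. Qed.

Lemma n_epiE (X Y : A) (f : Z0 X Y) : truncated A n -> n_epi n f <->
  forall (W : A) (u : hom Y W (- n%:Z + 1)),
    cc_closed u -> coboundary (precomp f W _ u) -> coboundary u.
Proof.
move=> trA; apply: (iff_trans (n_monoE (op_truncated trA) f)).
by split=> fe W u cu fu; apply: fe => //; move: fu; rewrite op_post.
Qed.

End OppositeExact.

Section OppositeAbelian.
Variables (k : comPzRingType) (A : dgcat k) (n : nat).

(** The double opposite carries squared signs and is not convertible to [A], so the two notions are
    compared through their criteria in degree 1 - n. *)
Lemma op_n_epi (X Y : A) (f : Z0 X Y) : truncated A n ->
  @n_epi k (op A) n Y X f <-> n_mono n f.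
Proof.
move=> trA; apply: (iff_trans (n_epiE (A := op A) _ (op_truncated trA))).
rewrite n_monoE //.
by split=> fm W u cu fu; apply: fm => //; move: fu; rewrite op_pre.
Qed.

Lemma op_H0_additive : H0_additive A -> H0_additive (op A).
Proof.
case=> [[O hO] bip]; split; first by exists O => W; have [] := hO W.
move=> X Y; have [P [i1 [i2 [p1 [p2 [e11 e22 e12 e21 e1]]]]]] := bip X Y.
exists P, p1, p2, i1, i2.
by split; rewrite /homotopic ?op_comp00.
Qed.

Lemma op_preabelian : preabelian A -> preabelian (op A).
Proof.
case=> addA kerA cokA; split; first exact: op_H0_additive.
- move=> Y Z g; have [X [f [h [dh ex]]]] := cokA Z Y g.
  by exists X, f, h, (op_complex_d dh); apply/(op_left_exact dh).
- move=> X Y f; have [Z [g [h [dh ex]]]] := kerA Y X f.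
  by exists Z, g, h, (op_complex_d dh); apply/(op_right_exact dh).
Qed.

Lemma op_abelian : abelian_truncated A n -> abelian_truncated (op A) n.
Proof.
case=> trA preA monoA epiA; split; first exact: op_truncated.
- exact: op_preabelian.
- case=> X Y Z f g h dh' rex fm.
  have dh : cc_d (addNr 1) (h : @hom k A Z X (-1)) = - cval (@comp0 k A Z Y X f g).
    by rewrite -op_comp00.
  have [lex rex'] := epiA (Complex3 dh) ((op_right_exact dh dh').1 rex) fm.
  by split; [apply/(op_left_exact dh) | apply/(op_right_exact dh)].
- case=> X Y Z f g h dh' lex ge.
  have dh : cc_d (addNr 1) (h : @hom k A Z X (-1)) = - cval (@comp0 k A Z Y X f g).
    by rewrite -op_comp00.
  have [lex' rex] := monoA (Complex3 dh) ((op_left_exact dh dh').1 lex) ((op_n_epi g trA).1 ge).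
  by split; [apply/(op_left_exact dh) | apply/(op_right_exact dh)].
Qed.

End OppositeAbelian.

Section Iso3Opposite.
Variables (k : comPzRingType) (A : dgcat k).

Lemma op_hequiv (X Y : A) (f : Z0 X Y) : hequiv f -> @hequiv k (op A) Y X f.
Proof. by case=> g [gf fg]; exists g; split; rewrite /homotopic op_comp00. Qed.

Definition op_complex (c : complex3 A) : complex3 (op A) :=
  @Complex3 k (op A) _ _ _ (c3g c) (c3f c) (c3h c) (op_complex_d (c3dh c)).

Lemma op_iso3 (c c' : complex3 A) :
  iso3 c c' -> iso3 (op_complex c') (op_complex c).
Proof.
case=> -[x y z s s' t ds ds' dt] /= [ex ey ez].
(* Reversing arrows swaps x with z and s with s', and negates each commutation defect, hence each
   homotopy. *)
unshelve eexists (@Mor3 k (op A) (op_complex c') (op_complex c)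
  z y x (- s') (- s) (- t) _ _ _).
- by rewrite !op_comp00 linearN /= ds' opprB.
- by rewrite !op_comp00 linearN /= ds opprB.
- rewrite linearN /= dt /op_comp !mul0r !mulr0 !scale1r.
  rewrite !(eq_irrelevance (etrans (addrC (-1) 0) _) (addr0 (-1))).
  rewrite !(eq_irrelevance (etrans (addrC 0 (-1)) _) (add0r (-1))).
  rewrite linearN compNl /= !opprD !opprK.
  by rewrite [LHS]addrC [_ + comp _ _ s]addrC [- _ + _]addrC !addrA [LHS]addrC !addrA.
by split; apply: op_hequiv.
Qed.

(** The dual isomorphism runs from c' to c, so right exactness uses the backward direction of
    [iso3_left_exact], and left exactness the forward one. *)
Lemma iso3_short_exact (c c' : complex3 A) :
  iso3 c c' -> short_exact c -> short_exact c'.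
Proof.
move=> iso [lex rex]; split; first exact/(iso3_left_exact iso).
case: c c' iso rex {lex} => X Y Z f g h dh [X' Y' Z' f' g' h' dh'] iso rex.
apply/(op_left_exact dh' (op_complex_d dh'))/(iso3_left_exact (op_iso3 iso)).
exact/(op_left_exact dh).
Qed.

End Iso3Opposite.

(** * Exactness of abelian n-truncated DG-categories *)

Section Exactness.
Variables (k : comPzRingType) (A : dgcat k) (n : nat).
Hypothesis n_gt0 : (0 < n)%N.
Hypothesis abA : abelian_truncated A n.

Let trA : truncated A n. Proof. by case: abA. Qed.

Lemma right_exact_n_epi (c : complex3 A) : right_exact c -> n_epi n (c3g c).
Proof.
case: c => X Y Z f g h dh rex.
have lex := (op_left_exact dh (op_complex_d dh)).2 rex.
exact: (left_exact_n_mono (op_truncated trA) n_gt0 lex).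
Qed.

Lemma inflationE (X Y : A) (f : Z0 X Y) :
  inflation (@short_exact k A) f <-> n_mono n f.
Proof.
split=> [[Z [g [h [dh [lex _]]]]]|fm].
  exact: (left_exact_n_mono trA n_gt0 lex).
case: abA => _ [_ _ cokA] monoA _; have [Z [g [h [dh rex]]]] := cokA X Y f.
by exists Z, g, h, dh; apply: monoA.
Qed.

Lemma deflationE (X Y : A) (f : Z0 X Y) :
  deflation (@short_exact k A) f <-> n_epi n f.
Proof.
split=> [[Z [g [h [dh [_ rex]]]]]|fe].
  exact: (right_exact_n_epi rex).
case: abA => _ [_ kerA _] _ epiA; have [Z [g [h [dh lex]]]] := kerA X Y f.
by exists Z, g, h, dh; apply: epiA.
Qed.

Lemma fiber_product_exists (X Y Z : A) (f : Z0 X Z) (a' : Z0 Y Z) :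
  exists (B : A) (g : Z0 B Y) (a : Z0 B X) (s : hom B Z (-1))
    (ds : cc_d (addNr 1) s = cval (comp0 f a) - cval (comp0 a' g)),
    hcartesian (Square ds).
Proof.
case: abA => _ [[_ bipA] kerA _] _ _.
have [P [i1 [i2 [p1 [p2 bip]]]]] := bipA X Y.
have [K [kap [h [dh lex]]]] := kerA P Z (copair p1 p2 f a').
exists K, (comp0 p2 kap), (comp0 p1 kap), (- h), (kernel_square_d dh).
exact: (kernel_cartesian bip lex).
Qed.

Lemma cartesian_n_epi (q : square A) :
  hcartesian q -> n_epi n (sqf q) -> n_epi n (sqg q).
Proof.
case: q => B Y X Z g a a' f s ds cart /= /(n_epiE _ trA) fe.
case: abA => _ [[_ bipA] kerA _] _ epiA.
have [P [i1 [i2 [p1 [p2 [e11 e22 e12 e21 e1]]]]]] := bipA X Y.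
set phi := copair p1 p2 f a'.
have [K [kap [h [dh lex]]]] := kerA P Z phi.
have ci1 W i (u : hom X W i) : cc_closed u ->
  coboundary (precomp i1 W i (precomp p1 W i u) - u).
  by move=> cu; have := pre_homotopic e11 cu; rewrite pre_comp0 pre_id.
have ci2 W i (u : hom Y W i) : cc_closed u ->
  coboundary (precomp i2 W i (precomp p2 W i u) - u).
  by move=> cu; have := pre_homotopic e22 cu; rewrite pre_comp0 pre_id.
have ci21 W i (u : hom Y W i) : cc_closed u ->
  coboundary (precomp i1 W i (precomp p2 W i u)).
  move=> cu; rewrite -pre_comp0; apply: comp_coboundaryr => //.
  by move/homotopicE: e21; rewrite subr0.
have phi_i1 W i (v : hom Z W i) : cc_closed v ->
  coboundary (precomp i1 W i (precomp phi W i v) - precomp f W i v).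
  move=> cv; rewrite pre_copair (linearB (precomp i1 W i)) /= addrAC.
  apply: coboundaryB; first exact/ci1/(cm_closed (precomp f W)).
  exact/ci21/(cm_closed (precomp a' W)).
(* Along [i1] the map phi restricts to f, so v phi ~ 0 forces v f ~ 0. *)
have phi_epi : n_epi n phi.
  apply/(n_epiE _ trA) => W v cv cphi; apply: fe => //.
  exact/(coboundary_sub (phi_i1 W _ v cv))/cm_coboundary.
have [_ rex] := epiA (Complex3 dh) lex phi_epi.
(* The two projections of K and the homotopy [h] form a cocycle in the fibre of the cospan; the
   Cartesian property lifts it to a map K -> B over Y, up to homotopy. *)
have [e0 ce0 ge0] : exists2 e : hom K B 0, cc_closed e &
    coboundary (postcomp g K 0 e - cval (comp0 p2 kap)).
  have [//|_ /H_surjE surj] := cart K 0.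
  have [|e ce [j [ej [[[w1 w2] w3] /= [_ dw2 _]]]]] :=
    surj ((cval (comp0 p1 kap), cval (comp0 p2 kap)), h).
    apply/fib_closedE; split.
      by congr pair; apply: cclosed.
    have e0 : cc_d (subrK 1 0 : -1 + 1 = 0 :> int) h = - cval (comp0 phi kap).
      by rewrite (eq_irrelevance (subrK 1 0 : -1 + 1 = 0 :> int) (addNr 1)).
    by rewrite [LHS]e0; congr (- _); apply: (post_copair p1 p2 f a' (cval kap)).
  by exists e => //; have := coboundary_d ej w2; rewrite dw2.
apply/(n_epiE _ trA) => W u cu cgu.
(* Indeed u p2 kap ~ u g e0 ~ 0. *)
have cpu : coboundary (precomp kap W _ (precomp p2 W _ u)).
  rewrite -pre_comp0.
  have h1 := comp_coboundaryr (addr0 (- n%:Z + 1)) cu ge0.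
  rewrite linearB /= in h1.
  apply/(coboundary_sub h1).
  rewrite /post_fun -(comp_assoc (addr0 _) _ (addr0 _)).
  exact: comp_coboundaryl.
have [//|_ /H_surjE surj] := rex W (- n%:Z + 1); first lia.
have [w dw] := coboundaryE (subrK 1 _) cpu.
(* The null-homotopy [w] of u p2 kap completes u p2 to a cocycle in the fibre of - o kap. *)
have [|v cv /fib_coboundaryE [w' /= dw' _]] := surj (precomp p2 W _ u, - w).
  apply/fib_closedE; split; first exact: (cm_closed (precomp p2 W)).
  by rewrite linearN /= dw.
have cvu : coboundary (precomp phi W _ v - precomp p2 W _ u).
  by rewrite -dw'; apply: coboundary_d.
(* Restriction along [i1] turns v phi into v f and u p2 into 0. *)
have cv0 : coboundary v.
  apply: fe => //; apply/(coboundary_sub (phi_i1 W _ v cv)).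
  have := cm_coboundary (precomp i1 W) cvu.
  rewrite (linearB (precomp i1 W _)) /= => h1.
  exact/(coboundary_sub h1)/ci21.
(* Restriction along [i2] recovers u from u p2 ~ v phi ~ 0. *)
apply/(coboundary_sub (ci2 W _ u cu))/cm_coboundary.
by apply/(coboundary_sub cvu)/cm_coboundary.
Qed.
End Exactness.

Theorem proposition3p14 (k : comPzRingType) (A : dgcat k) (n : nat)
    (n_gt0 : (0 < n)%N) (abA : abelian_truncated A n) :
  exact_dgcat (@short_exact k A) /\
  (forall (X Y : A) (f : Z0 X Y), inflation (@short_exact k A) f <-> n_mono n f) /\
  (forall (X Y : A) (f : Z0 X Y), deflation (@short_exact k A) f <-> n_epi n f).
Proof.
have [trA _ _ _] := abA; have op_abA := op_abelian abA.
have infE := inflationE n_gt0 abA; have defE := deflationE n_gt0 abA.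
split; last by [].
split.
- exact: iso3_short_exact.
- by move=> X; apply/defE; apply: (n_mono_id (op_truncated trA) X).
- move=> X Y Z g f /defE ge /defE fe; apply/defE/(n_epiE _ trA) => W u cu.
  rewrite pre_comp0 => cfgu; apply: ((n_epiE _ trA).1 ge) => //.
  by apply: ((n_epiE _ trA).1 fe) => //; apply: cm_closed.
- by move=> X Y Z f a' _; apply: fiber_product_exists abA _ _ _ f a'.
- move=> q cart /defE fe; apply/defE; exact: cartesian_n_epi.
- move=> X Y B a g _.
  have [Z [a' [f [s [ds cart]]]]] := @fiber_product_exists _ (op A) n op_abA X Y B a g.
  have ds' : cc_d (addNr 1) (s : @hom k A B Z (-1)) =
      cval (@comp0 k A _ _ _ f a) - cval (@comp0 k A _ _ _ a' g).
    by rewrite ds !op_comp00.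
  exists Z, a', f, s, ds'; move: cart; rewrite /hcocartesian /op_square /=.
  (* The two squares differ only in the proof of the equation for d(s), and such proofs are
     unique. *)
  by rewrite (eq_irrelevance ds (op_square_ds (Square ds'))).
- move=> q cart /infE am; apply/infE/(op_n_epi _ trA).
  apply: (cartesian_n_epi n_gt0 op_abA cart).
  exact/(op_n_epi _ trA).
Qed.
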